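(* Let $z_1,\dots,z_m$ be distinct points of $\partial\mathbb{D}$, let $\mu=\sum_{j=1}^m\mu_j\delta_{z_j}$ with $\mu_j>0$, $\sum_j\mu_j=1$, and let $G$ be a real-valued function on $\{z_1,\dots,z_m\}$, with the points numbered so that $G(z_1)\geq G(z_2)\geq\cdots\geq G(z_m)$. Let $K_1,\dots,K_L$ be the $K$-groups, $K_i=\{k_{i-1}+1,\dots,k_i\}$ ($k_0=0$, $k_L=m$), i.e. the maximal blocks of consecutive indices on which $G(z_\cdot)$ is constant, so $G(z_{k_i})>G(z_{k_i+1})$. For $t\ge0$ put $\Sigma_t(\mu)=e^{tG}\mu/\int e^{tG}d\mu$. For each $i$ put $z^{(K_i)}=\prod_{p=1}^{k_{i-1}}z_p$ and let $\mu^{(K_i)}=\sum_{\ell\in K_i}\mu^{(K_i)}_\ell\delta_{z_\ell}$ with \[ \mu^{(K_i)}_\ell=\frac{\bigl[\prod_{p=1}^{k_{i-1}}|z_\ell-z_p|^2\bigr]\mu_\ell}{\sum_{r\in K_i}\bigl[\prod_{p=1}^{k_{i-1}}|z_r-z_p|^2\bigr]\mu_r}. \] Then for every $i$ and every $\ell\in K_i$, \[ \lim_{t\to\infty}\alpha_{\ell-1}(\Sigma_t(\mu))=(-1)^{k_{i-1}}\,\overline{z^{(K_i)}}\;\alpha_{\ell-k_{i-1}-1}(\mu^{(K_i)}). \]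
   Context: For a positive finite measure $\nu$ on $\partial\mathbb{D}=\{|z|=1\}$ whose support has at least $n$ points, $\Phi_n(z;\nu)$ denotes the monic orthogonal polynomial of degree $n$ (the unique monic degree-$n$ polynomial orthogonal in $L^2(\nu)$ to all polynomials of lower degree). The Verblunsky coefficients are $\alpha_n(\nu)=-\overline{\Phi_{n+1}(0;\nu)}$ for $n+1\le\#\mathrm{supp}\,\nu$; equivalently $\Phi_{n+1}(z)=z\Phi_n(z)-\overline{\alpha_n}\Phi_n^*(z)$ with $\Phi_n^*(z)=z^n\overline{\Phi_n(1/\bar z)}$. An empty product equals $1$. *)

(* Defs.v *)
(* R : realType (MathComp-Analysis, for expR), complex numbers R[i]
   from mathcomp-real-closed. *)
From HB Require Import structures.
From mathcomp Require Import all_boot all_order all_algebra.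
From mathcomp Require Import complex.
From mathcomp Require Import reals.
From mathcomp Require Import sequences.
From Stdlib Require Import ClassicalEpsilon.

Set Implicit Arguments.
Unset Strict Implicit.
Unset Printing Implicit Defensive.

Import Order.TTheory GRing.Theory Num.Theory.
Local Open Scope ring_scope.

(* A finitely supported positive measure nu = sum_j w_j delta_{x_j} on the circle,
   given as the list of its atoms (x_j, w_j). *)
Definition dmeas (R : rcfType) := seq (R[i] * R).

(* The L^2(nu) inner product <P, Q> = \int P conj(Q) dnu. *)
Definition ip (R : rcfType) (nu : dmeas R) (P Q : {poly R[i]}) : R[i] :=
  \sum_(x <- nu) (x.2)%:C%C * P.[x.1] * (Q.[x.1])^*.

(* P is a monic polynomial of degree n orthogonal in L^2(nu) to all polynomials
   of lower degree (size Q <= n, i.e. deg Q < n or Q = 0). *)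
Definition is_monic_OP (R : rcfType) (nu : dmeas R) (n : nat) (P : {poly R[i]}) : Prop :=
  [/\ P \is monic, size P = n.+1 & forall Q : {poly R[i]}, (size Q <= n)%N -> ip nu P Q = 0].

(* Phi_n(.; nu): the (unique, when #supp nu >= n) monic orthogonal polynomial of degree n. *)
Definition Phi (R : rcfType) (nu : dmeas R) (n : nat) : {poly R[i]} :=
  epsilon (inhabits 0) (is_monic_OP nu n).

(* Verblunsky coefficient alpha_n(nu) = - conj (Phi_{n+1}(0; nu)). *)
Definition verblunsky (R : rcfType) (nu : dmeas R) (n : nat) : R[i] :=
  - (((Phi nu n.+1).[0])^*).

(* Sigma_t(mu) = e^{tG} mu / \int e^{tG} dmu, for mu = sum_j mu_j delta_{z_j}. *)
Definition Sigma (R : realType) (m : nat) (z : 'I_m -> R[i]) (mu : 'I_m -> R)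
  (G : R[i] -> R) (t : R) : dmeas R :=
  let Zt := \sum_(j < m) expR (t * G (z j)) * mu j in
  [seq (z j, expR (t * G (z j)) * mu j / Zt) | j <- enum 'I_m].

(* For the (0-based) index l, the K-group containing l is {kstart .. kend - 1}
   (0-based), i.e. in the paper's 1-based numbering K_i = {k_{i-1}+1, ..., k_i}
   with k_{i-1} = kstart and k_i = kend.  Since G(z_.) is non-increasing in the
   index, kstart = #{p : G(z_p) > G(z_l)} and kend = #{p : G(z_p) >= G(z_l)}. *)
Definition kstart (R : realType) (m : nat) (z : 'I_m -> R[i]) (G : R[i] -> R)
  (l : 'I_m) : nat := #|[set p : 'I_m | G (z l) < G (z p)]|.
Definition kend (R : realType) (m : nat) (z : 'I_m -> R[i]) (G : R[i] -> R)
  (l : 'I_m) : nat := #|[set p : 'I_m | G (z l) <= G (z p)]|.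

(* z^{(K_i)} = prod_{p=1}^{k_{i-1}} z_p *)
Definition zK (R : realType) (m : nat) (z : 'I_m -> R[i]) (G : R[i] -> R)
  (l : 'I_m) : R[i] := \prod_(p < m | (p < kstart z G l)%N) z p.

(* unnormalized weight [prod_{p=1}^{k_{i-1}} |z_r - z_p|^2] mu_r *)
Definition wK (R : realType) (m : nat) (z : 'I_m -> R[i]) (mu : 'I_m -> R)
  (G : R[i] -> R) (l r : 'I_m) : R :=
  (\prod_(p < m | (p < kstart z G l)%N) (Normc.normc (z r - z p)) ^+ 2) * mu r.

Definition inK (R : realType) (m : nat) (z : 'I_m -> R[i]) (G : R[i] -> R)
  (l r : 'I_m) : bool := (kstart z G l <= r)%N && (r < kend z G l)%N.

(* mu^{(K_i)} for the K-group K_i containing l. *)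
Definition muK (R : realType) (m : nat) (z : 'I_m -> R[i]) (mu : 'I_m -> R)
  (G : R[i] -> R) (l : 'I_m) : dmeas R :=
  let S := \sum_(r < m | inK z G l r) wK z mu G l r in
  [seq (z r, wK z mu G l r / S) | r <- enum 'I_m & inK z G l r].

(* lim_{t -> +oo} f t = L, for f : R -> C, with the modulus on C. *)
Definition cvg_pinfty (R : realType) (f : R -> R[i]) (L : R[i]) : Prop :=
  forall eps : R, 0 < eps -> exists T : R, forall t : R, T <= t ->
    `|f t - L| < eps%:C%C.

(* Main.v *)
Require Import Defs.
From HB Require Import structures.
From mathcomp Require Import all_boot all_order all_algebra.
From mathcomp Require Import complex.
From mathcomp Require Import reals.
From mathcomp Require Import sequences exp ring.
From Stdlib Require Import ClassicalEpsilon.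

Import Order.TTheory GRing.Theory Num.Theory.
Local Open Scope ring_scope.

(** Fix an index [l], put [g = G(z_l)], and split the points into the sets [A], [K],
    [B] where [G > g], [G = g], [G < g].  Rescaling by [e^{-tg}] changes no orthogonal
    polynomial, and turns the weights into [w_j = e^{t(G(z_j) - g)} mu_j].

    Let [P_t] be the monic orthogonal polynomial of degree [l + 1] of [Sigma_t(mu)], let
    [F = V * Phi_{l+1-k}(mu^(K))] with [V] the monic polynomial vanishing on [A], and
    [D = P_t - F], of degree at most [l].  Orthogonality of [P_t] to [D] gives
    [|D|^2 = - <F, D>] in [L^2(w)].  On [A], [F] vanishes.  On [K], write [D] as its
    Lagrange interpolant on [A] plus a multiple of [V]; the multiple of [V] is
    orthogonal to [F], so that [K] contributes a fixed linear form in the values of [D]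
    on [A].  As [|D(z_j)| <= |D| / sqrt w_j], this yields
    [|D| <= sum_A |c_j| / sqrt w_j + sum_B sqrt w_j |F(z_j)|], which tends to [0].
    Finally [D(0)] is a fixed linear form in the values of [D] at the points of index at
    most [l], whose weights are bounded below, hence [P_t(0)] tends to [F(0)]. *)

(** * Vanishing polynomials and Lagrange interpolation *)

Definition vanishing_poly {F : fieldType} {I : finType} (z : I -> F) (S : {set I}) :
    {poly F} :=
  \prod_(p in S) ('X - (z p)%:P).

Lemma size_vanishing_poly (F : fieldType) (I : finType) (z : I -> F) (S : {set I}) :
  size (vanishing_poly z S) = #|S|.+1.
Proof. by rewrite /vanishing_poly -big_enum size_prod_XsubC -cardE. Qed.

Lemma monic_vanishing_poly (F : fieldType) (I : finType) (z : I -> F) (S : {set I}) :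
  vanishing_poly z S \is monic.
Proof. by rewrite /vanishing_poly monic_prod_XsubC. Qed.

Lemma horner_vanishing_poly (F : fieldType) (I : finType) (z : I -> F) (S : {set I}) x :
  (vanishing_poly z S).[x] = \prod_(p in S) (x - z p).
Proof.
by rewrite /vanishing_poly horner_prod; apply: eq_bigr => p _; rewrite hornerXsubC.
Qed.

Lemma horner_vanishing_poly_eq0 (F : fieldType) (I : finType) (z : I -> F)
    (S : {set I}) i :
  i \in S -> (vanishing_poly z S).[z i] = 0.
Proof. by move=> iS; rewrite horner_vanishing_poly (bigD1 i) //= subrr mul0r. Qed.

Lemma dvdp_vanishing_poly (F : fieldType) (I : finType) (z : I -> F) (S : {set I})
    (p : {poly F}) :
  injective z -> (forall i, i \in S -> p.[z i] = 0) -> (vanishing_poly z S %| p)%R.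
Proof.
move=> zI p0.
have -> : vanishing_poly z S = \prod_(x <- map z (enum S)) ('X - x%:P).
  by rewrite big_map big_enum.
apply: uniq_roots_dvdp.
  by apply/allP => _ /mapP[i + ->]; rewrite mem_enum => /p0 /eqP.
by rewrite uniq_rootsE map_inj_uniq ?enum_uniq.
Qed.

(** The interpolation basis [L] is fixed before [D], so that linear forms built from it will not
    depend on [t]. Truncated subtraction in the bound on [Q] makes [Q = 0] as soon as
    [size D <= #|S|]. *)
Lemma lagrange_decomposition (F : fieldType) (I : finType) (z : I -> F) (S : {set I}) :
  injective z ->
  exists L : I -> {poly F}, forall D : {poly F}, exists2 Q : {poly F},
    (size Q <= size D - #|S|)%N &
    D = \sum_(i in S) D.[z i] *: L i + vanishing_poly z S * Q.
Proof.
move=> zI.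
pose V i := vanishing_poly z (S :\ i).
have V0 i : (V i).[z i] != 0.
  rewrite horner_vanishing_poly prodf_seq_neq0; apply/allP => p _.
  by apply/implyP; rewrite !inE subr_eq0 (inj_eq zI) eq_sym => /andP[].
exists (fun i => (V i).[z i]^-1 *: V i) => D.
set N := \sum_(i in S) _.
have sN : (size N <= #|S|)%N.
  apply: (leq_trans (size_sum _ _ _)); apply/bigmax_leqP => i iS.
  apply: (leq_trans (size_scale_leq _ _)); apply: (leq_trans (size_scale_leq _ _)).
  by rewrite size_vanishing_poly (cardsD1 i S) iS.
have dvd : (vanishing_poly z S %| D - N)%R.
  apply: dvdp_vanishing_poly => // i iS.
  rewrite hornerD hornerN horner_sum (bigD1 i) //= big1 => [|j /andP[jS ji]].
    by rewrite !hornerZ mulVf // mulr1 addr0 subrr.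
  have iSj : i \in S :\ j by rewrite !inE eq_sym ji.
  by rewrite !hornerZ (horner_vanishing_poly_eq0 _ _ _ _ _ iSj) !mulr0.
exists ((D - N) %/ vanishing_poly z S).
  rewrite size_divp ?monic_neq0 ?monic_vanishing_poly // size_vanishing_poly /=.
  have sDN : (size (D - N)%R <= maxn (size D) #|S|)%N.
    by rewrite (leq_trans (size_polyD _ _)) // size_polyN geq_max leq_maxl leq_max sN orbT.
  apply: leq_trans (leq_sub2r _ sDN) _.
  by rewrite /maxn; case: ifP => _; rewrite ?subnn.
by rewrite mulrC divpK // addrC subrK.
Qed.

(** * The inner product and existence of monic orthogonal polynomials *)

Lemma ip_suml (R : rcfType) (nu : dmeas R) (I : finType) (a : I -> R[i])
    (p : I -> {poly R[i]}) (Q : {poly R[i]}) :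
  ip nu (\sum_i a i *: p i) Q = \sum_i a i * ip nu (p i) Q.
Proof.
rewrite /ip (eq_bigr (fun x => \sum_i a i * (x.2%:C%C * (p i).[x.1] * (Q.[x.1])^*))).
  by rewrite exchange_big /=; apply: eq_bigr => i _; rewrite mulr_sumr.
move=> x _; rewrite horner_sum mulr_sumr mulr_suml; apply: eq_bigr => i _.
by rewrite hornerZ !mulrA (mulrC _ (a i)).
Qed.

Lemma ip_sumr (R : rcfType) (nu : dmeas R) (I : finType) (a : I -> R[i])
    (p : I -> {poly R[i]}) (P : {poly R[i]}) :
  ip nu P (\sum_i a i *: p i) = \sum_i (a i)^* * ip nu P (p i).
Proof.
rewrite /ip (eq_bigr (fun x => \sum_i (a i)^* * (x.2%:C%C * P.[x.1] * ((p i).[x.1])^*))).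
  by rewrite exchange_big /=; apply: eq_bigr => i _; rewrite mulr_sumr.
move=> x _; rewrite horner_sum rmorph_sum mulr_sumr; apply: eq_bigr => i _.
by rewrite hornerZ rmorphM /= mulrCA.
Qed.

Lemma ipDl (R : rcfType) (nu : dmeas R) (P1 P2 Q : {poly R[i]}) :
  ip nu (P1 + P2) Q = ip nu P1 Q + ip nu P2 Q.
Proof.
by rewrite /ip -big_split /=; apply: eq_bigr => x _; rewrite hornerD mulrDr mulrDl.
Qed.

Lemma ip_eq0 (R : rcfType) (nu : dmeas R) (p : {poly R[i]}) :
  uniq (unzip1 nu) -> (forall x, x \in nu -> 0 < x.2) ->
  (size p <= size nu)%N -> ip nu p p = 0 -> p = 0.
Proof.
move=> nu_uniq nu_gt0 sp /eqP.
rewrite /ip big_seq psumr_eq0 => [/allP p0|x xnu]; last first.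
  by rewrite -mulrA -normCK mulr_ge0 ?exprn_ge0 // ler0c ltW ?nu_gt0.
apply: (@roots_geq_poly_eq0 _ _ (unzip1 nu)); rewrite ?size_map // ?uniq_rootsE //.
apply/allP => _ /mapP[x xnu ->].
have := p0 x xnu; rewrite xnu /= -mulrA -normCK mulf_eq0 expf_eq0 normr_eq0 /=.
by case/orP => // /eqP/complexI x0; have := nu_gt0 x xnu; rewrite x0 ltxx.
Qed.

Lemma rVpoly_sum (K : nzRingType) n (u : 'rV[K]_n) :
  rVpoly u = \sum_(i < n) u 0 i *: 'X^i.
Proof.
by rewrite /rVpoly poly_def; apply: eq_bigr => i _; rewrite valK.
Qed.

Lemma size_le_sum (K : nzRingType) n (p : {poly K}) :
  (size p <= n)%N -> p = \sum_(i < n) p`_i *: 'X^i.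
Proof.
by move=> sp; rewrite -{1}(poly_rV_K sp) rVpoly_sum; apply: eq_bigr => i _; rewrite mxE.
Qed.

(** The Gram matrix of the monomials of degree below [n] is invertible: a vector in its kernel is a
    polynomial of norm zero, hence with at least [n] distinct roots. The lower coefficients of [P]
    then solve a linear system. *)
Lemma monic_OP_exists (R : rcfType) (nu : dmeas R) (n : nat) :
  uniq (unzip1 nu) -> (forall x, x \in nu -> 0 < x.2) -> (n <= size nu)%N ->
  exists P, is_monic_OP nu n P.
Proof.
move=> nu_uniq nu_gt0 n_le.
pose M : 'M_n := \matrix_(i, j) ip nu 'X^i 'X^j.
have uM (u : 'rV_n) (j : 'I_n) : ip nu (rVpoly u) 'X^j = (u *m M) 0 j.
  by rewrite rVpoly_sum ip_suml mxE; apply: eq_bigr => i _; rewrite mxE.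
have M_free : row_free M.
  apply: inj_row_free => u uM0; apply: (can_inj rVpolyK); rewrite linear0.
  apply: (ip_eq0 _ nu) => //; first exact: leq_trans (size_poly _ _) n_le.
  rewrite {2}rVpoly_sum ip_sumr big1 // => j _.
  by rewrite uM uM0 mxE mulr0.
pose b : 'rV_n := \row_j ip nu 'X^n 'X^j.
pose q := rVpoly (- b *m invmx M).
have sq : (size q < size ('X^n : {poly R[i]}))%N by rewrite size_polyXn ltnS size_poly.
exists ('X^n + q); split.
- by rewrite monicE lead_coefDl // lead_coefXn.
- by rewrite size_polyDl // size_polyXn.
- move=> Q /size_le_sum ->; rewrite ip_sumr big1 // => j _.
  rewrite ipDl uM mulmxKV -?row_free_unit // !mxE.
  by rewrite subrr mulr0.
Qed.

Lemma Phi_monic_OP (R : rcfType) (nu : dmeas R) (n : nat) :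
  uniq (unzip1 nu) -> (forall x, x \in nu -> 0 < x.2) -> (n <= size nu)%N ->
  is_monic_OP nu n (Phi nu n).
Proof. by move=> ? ? ?; apply: epsilon_spec; exact: monic_OP_exists. Qed.

(** * A norm estimate in weighted finite sums *)

Lemma sum_sqr_le_bound (C : numClosedFieldType) (I : finType) (u e : I -> C) :
  (forall j, 0 <= u j) -> (forall j, 0 <= e j) ->
  \sum_j u j ^+ 2 <= \sum_j e j * u j ->
  forall j, u j <= \sum_i e i.
Proof.
move=> u0 e0 le_ue j.
set N2 := \sum_j _ in le_ue.
have N20 : 0 <= N2 by apply: sumr_ge0 => i _; rewrite exprn_ge0.
have N0 : 0 <= sqrtC N2 by rewrite sqrtC_ge0.
have uN i : u i <= sqrtC N2.
  rewrite -(@ler_pXn2r _ 2) // ?nnegrE // sqrtCK /N2 (bigD1 i) //= lerDl.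
  by apply: sumr_ge0 => k _; rewrite exprn_ge0.
apply: (le_trans (uN j)).
have [->|Nn0] := eqVneq (sqrtC N2) 0; first exact: sumr_ge0.
have Ngt0 : 0 < sqrtC N2 by rewrite lt_def Nn0.
(* With [N] the Euclidean norm of [u], [N^2 <= sum e_i u_i <= N * sum e_i], and one factor [N]
   cancels. *)
rewrite -(ler_pM2r Ngt0) -expr2 sqrtCK (le_trans le_ue) // mulr_suml.
by apply: ler_sum => i _; rewrite ler_wpM2l.
Qed.

(* Orthogonality of [D + F] to [D] gives [|D|^2 = - <F, D>], and the right-hand
   side is linear in [D]. *)
Lemma weighted_diff_bound (C : numClosedFieldType) (I : finType) (A B : {set I})
    (v D F c : I -> C) :
  (forall j, 0 < v j) ->
  \sum_j v j ^+ 2 * (D j + F j) * (D j)^* = 0 ->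
  \sum_j v j ^+ 2 * F j * (D j)^* =
    \sum_(j in A) c j * (D j)^* + \sum_(j in B) v j ^+ 2 * F j * (D j)^* ->
  forall j, v j * `|D j| <=
    \sum_(i in A) `|c i| / v i + \sum_(i in B) v i * `|F i|.
Proof.
move=> v0 orth FD j.
have vn i : v i != 0 by rewrite gt_eqF.
(* Chosen so that [e i * (v i * |D i|)] is the sum of the moduli of the terms of index [i] in the
   linear form. *)
pose e i := (if i \in A then `|c i| / v i else 0) +
            (if i \in B then v i * `|F i| else 0).
have e0 i : 0 <= e i.
  by rewrite addr_ge0 //; case: ifP => // _; rewrite ?divr_ge0 ?mulr_ge0 // ltW.
have vD0 i : 0 <= v i * `|D i| by rewrite mulr_ge0 // ltW.
suff /sum_sqr_le_bound - /(_ vD0 e0 j) :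
    \sum_j (v j * `|D j|) ^+ 2 <= \sum_j e j * (v j * `|D j|).
  by rewrite big_split /= -!big_mkcond.
have E : \sum_j e j * (v j * `|D j|) =
    \sum_(j in A) `|c j * (D j)^*| + \sum_(j in B) `|v j ^+ 2 * F j * (D j)^*|.
  rewrite !(big_mkcond (fun j => j \in _)) /= -big_split /=; apply: eq_bigr => i _.
  rewrite mulrDl; congr (_ + _); case: ifP => _; rewrite ?mul0r //.
    by rewrite normrM norm_conjC mulrA divfK.
  rewrite expr2 !normrM norm_conjC (gtr0_norm (v0 i)) !mulrA.
  by congr (_ * _); rewrite -!mulrA (mulrC `|F i|).
have S0 : 0 <= \sum_j (v j * `|D j|) ^+ 2.
  by apply: sumr_ge0 => i _; rewrite exprn_ge0.
have NE : \sum_j (v j * `|D j|) ^+ 2 = - \sum_j v j ^+ 2 * F j * (D j)^*.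
  apply/eqP; rewrite -addr_eq0 -big_split /= -[X in _ == X]orth; apply/eqP.
  by apply: eq_bigr => i _; rewrite exprMn normCK mulrDr mulrDl mulrA.
rewrite -(ger0_norm S0) NE normrN FD E (le_trans (ler_normD _ _)) //.
by rewrite lerD // ler_norm_sum.
Qed.

(** * Limits at infinity *)

Lemma cvg_pinfty_squeeze (R : realType) (f h : R -> R[i]) (L : R[i]) :
  (forall t, 0 <= t -> `|f t - L| <= h t) -> cvg_pinfty h 0 -> cvg_pinfty f L.
Proof.
move=> fh h0 eps /h0[T hT]; exists (Num.max 0 T) => t.
rewrite ge_max => /andP[t0 /hT]; rewrite subr0; apply: le_lt_trans.
by rewrite (le_trans (fh t t0)) // ger0_norm // (le_trans _ (fh t t0)).
Qed.

Lemma cvg_pinfty_scale0 (R : realType) (f : R -> R[i]) (c : R[i]) :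
  cvg_pinfty f 0 -> cvg_pinfty (fun t => c * f t) 0.
Proof.
move=> f0 eps eps0.
have n0 : 0 <= Normc.normc c by rewrite -ler0c -[_%:C%C]/`|c| normr_ge0.
(* Dividing by [1 + |c|] rather than [|c|] covers [c = 0]. *)
have d0 : 0 < eps / (1 + Normc.normc c) by rewrite divr_gt0 // ltr_pwDl.
have [T fT] := f0 _ d0; exists T => t /fT; rewrite !subr0 normrM => ft.
have -> : `|c| = (Normc.normc c)%:C%C by [].
apply: (@le_lt_trans _ _ ((1 + Normc.normc c)%:C%C * `|f t|)).
  by rewrite ler_wpM2r // lecR lerDr.
have c1 : 0 < 1 + Normc.normc c by rewrite ltr_pwDl.
have -> : eps%:C%C = (1 + Normc.normc c)%:C%C * (eps / (1 + Normc.normc c))%:C%C.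
  by rewrite -rmorphM mulrCA divff ?mulr1 ?gt_eqF.
by rewrite ltr_pM2l // ltcR.
Qed.

Lemma cvg_pinfty_add0 (R : realType) (f g : R -> R[i]) :
  cvg_pinfty f 0 -> cvg_pinfty g 0 -> cvg_pinfty (fun t => f t + g t) 0.
Proof.
move=> f0 g0 eps eps0; have e2 : 0 < eps / 2 by rewrite divr_gt0.
have [[T fT] [U gU]] := (f0 _ e2, g0 _ e2); exists (Num.max T U) => t.
rewrite ge_max => /andP[/fT + /gU]; rewrite !subr0 => ft gt.
by rewrite (le_lt_trans (ler_normD _ _)) // [eps]splitr rmorphD ltrD.
Qed.

Lemma cvg_pinfty_sum0 (R : realType) (I : finType) (S : {set I}) (f : I -> R -> R[i]) :
  (forall i, i \in S -> cvg_pinfty (f i) 0) ->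
  cvg_pinfty (fun t => \sum_(i in S) f i t) 0.
Proof.
move=> f0.
have zero : cvg_pinfty (fun _ : R => 0 : R[i]) 0.
  by move=> eps eps0; exists 0 => t _; rewrite subr0 normr0 ltcR.
suff /(_ (enum S)) : forall s : seq I, {subset s <= S} ->
    cvg_pinfty (fun t => \sum_(i <- s) f i t) 0.
  move=> H eps /H[|T HT]; first by move=> i; rewrite mem_enum.
  by exists T => t /HT; rewrite big_enum.
elim=> [_|i s IH sS]; first by move=> eps /zero[T HT]; exists T => t /HT; rewrite big_nil.
have fi := f0 i (sS i (mem_head _ _)).
have fs : cvg_pinfty (fun t => \sum_(i <- s) f i t) 0.
  by apply: IH => j js; apply: sS; rewrite inE js orbT.
move=> eps /(cvg_pinfty_add0 _ _ _ fi fs)[T HT]; exists T => t /HT.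
by rewrite big_cons.
Qed.

Lemma cvg_pinfty_expR (R : realType) (d : R) :
  d < 0 -> cvg_pinfty (fun t => (expR (t * d))%:C%C) 0.
Proof.
(* The threshold comes from [e^{-td} >= 1 - td > 1/eps]. *)
move=> d0 eps eps0; exists (eps^-1 / - d) => t tT.
rewrite subr0 ger0_norm ?ler0c ?expR_ge0 // ltcR.
rewrite -[t * d]opprK expRN invf_plt ?posrE ?expR_gt0 //.
rewrite (lt_le_trans _ (expR_ge1Dx _)) // ltr_pwDl // -mulrN.
by rewrite -ler_pdivrMr // oppr_gt0.
Qed.

(** * Initial segments of indices, and other preliminaries *)

Lemma card_ord_ltn (m k : nat) : (k <= m)%N -> #|[set p : 'I_m | (p < k)%N]| = k.
Proof.
move=> km; rewrite -sum1_card (eq_bigl (fun p : 'I_m => (p < k)%N)); last first.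
  by move=> p; rewrite inE.
by rewrite (big_ord_narrow km) sum_nat_const card_ord muln1.
Qed.

(** Since [kstart] and [kend] are cardinalities, this is what turns conditions on an index into
    conditions on the value of [G] there. *)
Lemma down_closed_ord (m : nat) (S : {set 'I_m}) :
  (forall p q : 'I_m, (p <= q)%N -> q \in S -> p \in S) ->
  forall p : 'I_m, (p < #|S|)%N = (p \in S).
Proof.
move=> dS p; apply/idP/idP => [pS|pS]; last first.
  rewrite -(card_ord_ltn m p.+1 (ltn_ord p)); apply: subset_leq_card.
  by apply/subsetP => q; rewrite inE ltnS => /dS; apply.
apply: contraLR pS => pS; rewrite -leqNgt -(card_ord_ltn m p (ltnW (ltn_ord p))).
apply: subset_leq_card; apply/subsetP => q qS; rewrite inE ltnNge.
by apply: contra pS => /dS; apply.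
Qed.

Lemma Phi_atoms (R : rcfType) (I : finType) (z : I -> R[i]) (w : I -> R)
    (s : seq I) (n : nat) :
  injective z -> uniq s -> (forall r, r \in s -> 0 < w r) -> (n <= size s)%N ->
  is_monic_OP [seq (z r, w r) | r <- s] n (Phi [seq (z r, w r) | r <- s] n).
Proof.
move=> zI us w0 ns; apply: Phi_monic_OP; last by rewrite size_map.
  by rewrite /unzip1 -map_comp (map_inj_uniq (f := z)).
by move=> _ /mapP[r /w0 ? ->].
Qed.

Lemma sumr_gt0_mem (R : numDomainType) (I : finType) (P : pred I) (F : I -> R) i :
  P i -> (forall j, P j -> 0 < F j) -> 0 < \sum_(j | P j) F j.
Proof.
move=> Pi F0; rewrite (bigD1 i) //= ltr_pwDl ?F0 // sumr_ge0 // => j /andP[Pj _].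
by rewrite ltW ?F0.
Qed.

Lemma size_monicB (S : nzRingType) n (p q : {poly S}) :
  p \is monic -> q \is monic -> size p = n.+1 -> size q = n.+1 ->
  (size (p - q)%R <= n)%N.
Proof.
move=> /eqP pm /eqP qm sp sq; apply/leq_sizeP => j; rewrite leq_eqVlt coefB.
case/orP => [/eqP <-|nj]; last by rewrite !nth_default ?subrr ?sp ?sq.
by move: pm qm; rewrite /lead_coef sp sq /= => -> ->; rewrite subrr.
Qed.

(** * The limit of the orthogonal polynomials of [Sigma] at 0 *)

Section Limit.
Context {R : realType} {m : nat} (z : 'I_m -> R[i]) (mu : 'I_m -> R) (G : R[i] -> R).
Context (zI : injective z) (mu_gt0 : forall j, 0 < mu j).
Context (G_anti : forall p q : 'I_m, (p <= q)%N -> G (z q) <= G (z p)) (l : 'I_m).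

Local Notation g := (G (z l)).
Local Notation k := (kstart z G l).
Let A := [set p : 'I_m | g < G (z p)].
Let K := [set p : 'I_m | G (z p) == g].
Let B := [set p : 'I_m | G (z p) < g].
Let V := vanishing_poly z A.

Lemma ltn_kstart (p : 'I_m) : (p < k)%N = (p \in A).
Proof.
apply: down_closed_ord => {}p q /G_anti Gpq; rewrite !inE => Gq.
exact: lt_le_trans Gpq.
Qed.

Lemma ltn_kend (p : 'I_m) : (p < kend z G l)%N = (g <= G (z p)).
Proof.
rewrite down_closed_ord ?inE // => {}p q /G_anti Gpq; rewrite !inE => Gq.
exact: le_trans Gpq.
Qed.

Lemma inKE (p : 'I_m) : inK z G l p = (p \in K).
Proof. by rewrite /inK leqNgt ltn_kstart ltn_kend !inE -leNgt eq_le. Qed.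

Lemma kstart_le : (k <= l)%N.
Proof. by rewrite leqNgt ltn_kstart inE ltxx. Qed.

(** Ensures that [mu^(K)] has enough atoms for a monic orthogonal polynomial of degree [l - k + 1].
    It holds because [l < kend = k + #|K|]. *)
Lemma card_K : (l - k < #|K|)%N.
Proof.
have : (kend z G l = k + #|K|)%N.
  have AK : A :&: K = set0 by apply/setP => p; rewrite !inE; case: ltgtP.
  have := cardsUI A K; rewrite AK cards0 addn0 => <-.
  by apply: eq_card => p; rewrite !inE le_eqVlt orbC [g == _]eq_sym.
have := ltn_kend l; rewrite lexx => + kE; rewrite kE => ?.
by rewrite ltn_subLR ?kstart_le.
Qed.

Lemma zKE : V.[0] = (-1) ^+ k * zK z G l.
Proof.
rewrite horner_vanishing_poly /zK (eq_bigl _ _ ltn_kstart).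
under eq_bigr do rewrite sub0r -mulN1r.
by rewrite big_split /= prodr_const.
Qed.

Lemma wKE (r : 'I_m) : (wK z mu G l r)%:C%C = `|V.[z r]| ^+ 2 * (mu r)%:C%C.
Proof.
rewrite horner_vanishing_poly /wK rmorphM rmorph_prod normr_prod -prodrXl.
congr (_ * _); rewrite (eq_bigl _ _ ltn_kstart).
by apply: eq_bigr => p _; rewrite rmorphXn.
Qed.

Lemma wK_gt0 (r : 'I_m) : r \in K -> 0 < wK z mu G l r.
Proof.
rewrite inE => /eqP rK; rewrite -ltcR wKE mulr_gt0 ?ltcR // exprn_gt0 // normr_gt0.
rewrite horner_vanishing_poly prodf_seq_neq0; apply/allP => p _; apply/implyP.
by rewrite inE subr_eq0 (inj_eq zI) => gp; apply: contraTneq gp => <-; rewrite rK ltxx.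
Qed.

Local Notation PhiK := (Phi (muK z mu G l) (l - k).+1).

Lemma PhiK_monic_OP : is_monic_OP (muK z mu G l) (l - k).+1 PhiK.
Proof.
apply: Phi_atoms => //; first by rewrite filter_uniq ?enum_uniq.
  move=> r; rewrite mem_filter inKE => /andP[rK _].
  rewrite divr_gt0 ?wK_gt0 // (sumr_gt0_mem _ _ _ _ l) // => [|j].
    by rewrite inKE inE.
  by rewrite inKE; apply: wK_gt0.
have -> : size [seq r <- enum 'I_m | inK z G l r] = #|K|.
  have u : uniq [seq r <- enum 'I_m | inK z G l r] by rewrite filter_uniq ?enum_uniq.
  by rewrite -(card_uniqP u); apply: eq_card => p; rewrite mem_filter mem_enum inKE andbT.
exact: card_K.
Qed.

(** The factor [|V|^2] in the weights of [mu^(K)] splits into [V] and its conjugate, one for each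
    argument of the inner product. *)
Lemma PhiK_orth (Q : {poly R[i]}) : (size Q <= (l - k).+1)%N ->
  \sum_(r in K) (mu r)%:C%C * (V * PhiK).[z r] * ((V * Q).[z r])^* = 0.
Proof.
have [_ _ orth] := PhiK_monic_OP => /orth {orth}.
have KE r : (r \in 'I_m) && inK z G l r = (r \in K) by rewrite inKE.
rewrite /ip /muK big_map big_filter big_enum_cond /= (eq_bigl _ _ KE).
set S := \sum_(r < m | inK z G l r) wK _ _ _ _ _.
have S0 : S%:C%C != 0.
  rewrite lt0r_neq0 // ltcR (sumr_gt0_mem _ _ _ _ l) // => [|j]; first by rewrite inKE inE.
  by rewrite inKE; apply: wK_gt0.
move=> /(congr1 (fun x => S%:C%C * x)); rewrite mulr0 mulr_sumr => E; rewrite -[RHS]E {E}.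
apply: eq_bigr => r _.
rewrite rmorphM fmorphV /= wKE normCK !hornerM rmorphM /= !mulrA.
by field.
Qed.

Local Notation PhiS t := (Phi (Sigma z mu G t) l.+1).
Let F := V * PhiK.

(* Square root of the weight [e^{t (G - g)} mu], a rescaling of [Sigma_t(mu)]
   which is constant on [K], blows up on [A] and decays on [B]. *)
Let v t j : R[i] := (expR (t * ((G (z j) - g) / 2)) * Num.sqrt (mu j))%:C%C.

Lemma v_gt0 t j : 0 < v t j.
Proof. by rewrite ltcR mulr_gt0 ?expR_gt0 // sqrtr_gt0. Qed.

Lemma v_sqr t j : v t j ^+ 2 = (expR (t * (G (z j) - g)) * mu j)%:C%C.
Proof.
rewrite -rmorphXn exprMn sqr_sqrtr ?ltW // -expRM_natr; congr ((expR _ * _)%:C%C).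
by field.
Qed.

Lemma v_sqrK t j : j \in K -> v t j ^+ 2 = (mu j)%:C%C.
Proof. by rewrite inE => /eqP gj; rewrite v_sqr gj subrr mulr0 expR0 mul1r. Qed.

Lemma PhiS_monic_OP t : is_monic_OP (Sigma z mu G t) l.+1 (PhiS t).
Proof.
apply: Phi_atoms => //; rewrite ?enum_uniq ?size_enum_ord // => r _.
have ? j : 0 < expR (t * G (z j)) * mu j by rewrite mulr_gt0 ?expR_gt0.
by rewrite divr_gt0 // (sumr_gt0_mem _ _ _ _ l).
Qed.

Lemma PhiS_orth t (Q : {poly R[i]}) : (size Q <= l.+1)%N ->
  \sum_j v t j ^+ 2 * (PhiS t).[z j] * (Q.[z j])^* = 0.
Proof.
have [_ _ orth] := PhiS_monic_OP t => /orth.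
rewrite /ip /Sigma big_map big_enum /=.
set Z := \sum_(j < m) expR _ * _.
have Z0 : Z != 0.
  by rewrite gt_eqF // (sumr_gt0_mem _ _ _ _ l) // => j _; rewrite mulr_gt0 ?expR_gt0.
(* This factor undoes the normalization and turns the weights of [Sigma] into [v t j ^+ 2]. *)
move=> /(congr1 (fun x => (Z * expR (- (t * g)))%:C%C * x)).
rewrite mulr0 mulr_sumr => E; rewrite -[RHS]E {E}.
apply: eq_bigr => r _; rewrite v_sqr !mulrA -rmorphM; congr (_%:C%C * _ * _).
by rewrite mulrBr expRD; field.
Qed.

Lemma size_PhiSB t : (size (PhiS t - F)%R <= l.+1)%N.
Proof.
have [Pm sP _] := PhiS_monic_OP t; have [Km sK _] := PhiK_monic_OP.
apply: size_monicB => //; first by rewrite monicMl // monic_vanishing_poly.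
rewrite size_monicM ?monic_vanishing_poly ?monic_neq0 // size_vanishing_poly sK.
by rewrite -[#|A|]/k addSn addnS /= addnS subnKC ?kstart_le.
Qed.

Lemma F_on_A i : i \in A -> F.[z i] = 0.
Proof. by move=> iA; rewrite hornerM horner_vanishing_poly_eq0 ?mul0r. Qed.

Lemma sum_ABK (f : 'I_m -> R[i]) :
  \sum_j f j = \sum_(j in A) f j + \sum_(j in B) f j + \sum_(j in K) f j.
Proof.
rewrite !(big_mkcond (fun j => j \in _)) -!big_split; apply: eq_bigr => j _ /=.
by rewrite !inE; case: ltgtP; rewrite ?addr0 ?add0r.
Qed.

Lemma PhiS_diff_bound : exists c : 'I_m -> R[i], forall t j,
  v t j * `|(PhiS t - F).[z j]| <=
    \sum_(i in A) `|c i| / v t i + \sum_(i in B) v t i * `|F.[z i]|.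
Proof.
have [L LD] := lagrange_decomposition _ _ _ A zI.
(* Pairing on [K] of [F] with the [i]-th Lagrange polynomial; it is free of [t] because the weights
   on [K] are. *)
exists (fun i => \sum_(j in K) (mu j)%:C%C * F.[z j] * ((L i).[z j])^*) => t.
set D := PhiS t - F.
apply: (weighted_diff_bound _ _ A B (v t) (fun i => D.[z i]) (fun i => F.[z i])).
- exact: v_gt0.
- rewrite -[RHS](PhiS_orth t D (size_PhiSB t)); apply: eq_bigr => j _.
  by rewrite -hornerD subrK.
rewrite sum_ABK big1 ?add0r => [|j jA]; last by rewrite F_on_A ?mulr0 ?mul0r.
rewrite addrC; congr (_ + _).
have [Q sQ DE] := LD D.
have /PhiK_orth VQ : (size Q <= (l - k).+1)%N.
  by rewrite (leq_trans sQ) // -subSn ?kstart_le // leq_sub2r // size_PhiSB.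
under [RHS]eq_bigr do rewrite mulr_suml.
(* Subtracting the vanishing pairing of [F] with [V * Q] replaces [D] on [K] by its interpolant on
   [A]. *)
rewrite exchange_big /= -[LHS]subr0 -[X in _ - X]VQ -sumrB; apply: eq_bigr => j jK.
rewrite v_sqrK // -mulrBr -rmorphB -hornerN -hornerD.
have -> : D - V * Q = \sum_(i in A) D.[z i] *: L i by rewrite {1}DE addrK.
rewrite horner_sum rmorph_sum mulr_sumr; apply: eq_bigr => i _.
by rewrite hornerZ rmorphM /= mulrA mulrAC.
Qed.

Lemma cvg_PhiS0 : cvg_pinfty (fun t => (PhiS t).[0]) F.[0].
Proof.
have [c bound] := PhiS_diff_bound.
(* The nodes are now the [l + 1] points of index at most [l]: enough to determine a polynomial of
   degree at most [l], and all in [A] or [K], where the weights do not decay. *)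
have [L LD] := lagrange_decomposition _ _ _ [set p : 'I_m | (p < l.+1)%N] zI.
pose s j : R[i] := (Num.sqrt (mu j))%:C%C.
have s0 j : 0 < s j by rewrite ltcR sqrtr_gt0.
pose M := \sum_(j < m | (j < l.+1)%N) `|(L j).[0]| / s j.
(* The bound of [PhiS_diff_bound], with the decaying exponentials isolated. *)
pose h t := \sum_(i in A) `|c i| / s i * (expR (t * ((g - G (z i)) / 2)))%:C%C +
  \sum_(i in B) s i * `|F.[z i]| * (expR (t * ((G (z i) - g) / 2)))%:C%C.
apply: (@cvg_pinfty_squeeze _ _ (fun t => M * h t)); last first.
  apply: cvg_pinfty_scale0; apply: cvg_pinfty_add0; apply: cvg_pinfty_sum0 => i;
    rewrite inE => gi; apply: cvg_pinfty_scale0; apply: cvg_pinfty_expR;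
    by rewrite pmulr_llt0 ?invr_gt0 // subr_lt0.
move=> t t0.
have hE : h t = \sum_(i in A) `|c i| / v t i + \sum_(i in B) v t i * `|F.[z i]|.
  congr (_ + _); apply: eq_bigr => i _; rewrite /v rmorphM /=; last first.
    by rewrite [LHS]mulrC -[RHS]mulrA.
  rewrite -mulrA; congr (_ * _); rewrite invfM mulrC; congr (_ / _).
  by rewrite -fmorphV -expRN -mulrN -mulNr opprB.
rewrite -hornerN -hornerD.
have [Q] := LD (PhiS t - F); set D := PhiS t - F.
rewrite card_ord_ltn // => sQ DE.
have {sQ} Q0 : Q = 0.
  apply/eqP; rewrite -size_poly_leq0 (leq_trans sQ) // leq_subLR addn0.
  exact: size_PhiSB.
rewrite [X in X.[0]]DE Q0 mulr0 addr0 horner_sum (le_trans (ler_norm_sum _ _ _)) //.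
rewrite /M mulr_suml (eq_bigl (fun j : 'I_m => (j < l.+1)%N)); last first.
  by move=> j; rewrite inE.
apply: ler_sum => j jl; rewrite hornerZ normrM mulrC -mulrA ler_wpM2l //.
rewrite mulrC ler_pdivlMr // mulrC hE; apply: le_trans (bound t j).
(* Here [s j <= v t j], because [t >= 0] and [j <= l] gives [G (z j) >= g]. *)
rewrite ler_wpM2r // lecR ler_peMl ?sqrtr_ge0 //.
rewrite -[leLHS]expR0 ler_expR mulr_ge0 // divr_ge0 // subr_ge0.
exact: G_anti.
Qed.

End Limit.

(* Indices are 0-based: the paper's z_l (l = 1..m) is z (l-1).  For the 0-based
   index l in K_i, alpha_{l-1} becomes verblunsky _ l and alpha_{l-k_{i-1}-1}
   becomes verblunsky _ (l - k_{i-1}). *)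
Theorem theorem1p5 (R : realType) (m : nat) (z : 'I_m -> R[i]) (mu : 'I_m -> R)
    (G : R[i] -> R) :
  injective z ->
  (forall j, `|z j| = 1) ->
  (forall j, 0 < mu j) ->
  \sum_(j < m) mu j = 1 ->
  (forall p q : 'I_m, (p <= q)%N -> G (z q) <= G (z p)) ->
  forall l : 'I_m,
    cvg_pinfty (fun t => verblunsky (Sigma z mu G t) l)
      ((-1) ^+ kstart z G l * (zK z G l)^* *
         verblunsky (muK z mu G l) (l - kstart z G l)).
Proof.
move=> zI _ mu0 _ G_anti l.
have cvgP := cvg_PhiS0 z mu G zI mu0 G_anti l.
move=> eps /cvgP[T PT]; exists T => t /PT; congr (_ < _).
(* Conjugation and change of sign preserve the modulus, so the limit of [Phi] at 0 transfers to the
   coefficients; [V.[0]] supplies the sign and the product of the [z p]. *)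
rewrite -[LHS]norm_conjC rmorphB /= -normrN opprB addrC.
rewrite hornerM zKE // !rmorphM /= rmorphXn rmorphN1.
by rewrite /verblunsky mulrN opprK.
Qed.
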